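(* Let $d\in\mathbb{N}$ and $\mathcal{T}\in\{J_1,J_2,M_1,M_2\}$. For each $n\in\mathbb{N}$ let $y^{(n)}=(y^{(n)}_0,y^{(n)}_1,y^{(n)}_2,\ldots)$ be a sequence in $\mathbb{R}^d$ and let $x^{n,J_1}\in D[0,1]$ be its step function embedding, i.e. $x^{n,J_1}(t)=y^{(n)}_k$ for $t\in[\frac kn,\frac{k+1}n)$, $0\le k<n$, and $x^{n,J_1}(1)=y^{(n)}_{n-1}$. If $x^{n,J_1}$ converges in $J_1$ (as $n\to\infty$), then $x^{n,J_1}$ also converges in $\mathcal{T}$.
   Context: $[[x,y]]=\{\alpha x+(1-\alpha)y:\alpha\in[0,1]\}$ for $x,y\in\mathbb{R}^d$, and $\|\cdot\|_\infty$ is the supremum norm. $D[0,1]$ is the set of functions $f:[0,1]\to\mathbb{R}^d$ that are right continuous with left limits and left continuous at $1$; $f(t-)$ is the left limit, with $f(0-):=f(0)$. Metrics on $D[0,1]$. Let $\Gamma_f=\{(z,t)\in\mathbb{R}^d\times[0,1]: z=f(t-)\text{ or }z=f(t)\}$ (incomplete graph) and $\overline{\Gamma_f}=\{(z,t)\in\mathbb{R}^d\times[0,1]: z\in[[f(t-),f(t)]]\}$ (complete graph). Order $\overline{\Gamma_f}$ by $(z_1,t_1)\le(z_2,t_2)$ if $t_1<t_2$, or $t_1=t_2$ and $|f(t_1-)-z_1|\le|f(t_2-)-z_2|$. Let $\pi(\overline{\Gamma_f})$ be the set of pairs $(u,r)$ with $u:[0,1]\to\mathbb{R}^d$ and $r:[0,1]\to[0,1]$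 continuous, $(u,r)$ non-decreasing for this order, and $(u,r)([0,1])=\overline{\Gamma_f}$. Let $\Lambda_c$ be the set of continuous bijections of $[0,1]$. For $A,B\subset\mathbb{R}^d\times[0,1]$ let $m_H(A,B)=\inf\{\varepsilon>0:A\subset B^\varepsilon,\ B\subset A^\varepsilon\}$ with $B^\varepsilon=\{(x,t)\in\mathbb{R}^d\times[0,1]:\exists (y,s)\in B,\ |x-y|\vee|t-s|\le\varepsilon\}$. Then $d_{J_1}(f_1,f_2)=\inf_{\lambda\in\Lambda_c}\{\|f_1\circ\lambda-f_2\|_\infty\vee\|\lambda-\mathrm{id}\|_\infty\}$, $d_{M_1}(f_1,f_2)=\inf\{\|u_1-u_2\|_\infty\vee\|r_1-r_2\|_\infty:(u_j,r_j)\in\pi(\overline{\Gamma_{f_j}}),\ j=1,2\}$, $d_{J_2}(f_1,f_2)=m_H(\Gamma_{f_1},\Gamma_{f_2})$, $d_{M_2}(f_1,f_2)=m_H(\overline{\Gamma_{f_1}},\overline{\Gamma_{f_2}})$. A sequence $f_n\in D[0,1]$ converges in $\mathcal{T}$ if there is $f\in D[0,1]$ with $d_{\mathcal{T}}(f_n,f)\to0$. *)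

(* Defs.v *)
From HB Require Import structures.
From mathcomp Require Import all_boot all_order all_algebra.
From mathcomp Require Import all_classical all_reals all_analysis.

Set Implicit Arguments.
Unset Strict Implicit.
Unset Printing Implicit Defensive.

Import Order.TTheory GRing.Theory Num.Theory.
Import numFieldNormedType.Exports.

Local Open Scope classical_set_scope.
Local Open Scope ring_scope.

(* Functions on [0,1] are represented by total functions on R; every notion
   below only depends on their values on [0,1]. *)

Section Skorokhod.
Context {R : realType} {d : nat}.

Implicit Types (f g u : R -> 'rV[R]_d) (y : nat -> 'rV[R]_d).

(* The library norm on 'rV[R]_d is the maximum norm, hence this definition;
   both norms induce the library topology. *)
Definition enorm (z : 'rV[R]_d) : R := Num.sqrt (\sum_(i < d) z ord0 i ^+ 2).

Definition segment (a b : 'rV[R]_d) : set 'rV[R]_d :=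
  [set alpha *: a + (1 - alpha) *: b | alpha in `[0, 1]].

Definition D01 f : Prop :=
  [/\ forall t : R, 0 <= t < 1 -> f @ t^'+ --> f t,
      forall t : R, 0 < t <= 1 -> cvg (f @ t^'-)
    & f @ (1 : R)^'- --> f 1].

(* f(t-), with f(0-) = f(0) *)
Definition left_limit f (t : R) : 'rV[R]_d :=
  if t <= 0 then f 0 else lim (f @ t^'-).

(* Suprema and infima are taken in \bar R, so that no junk value arises from
   unbounded or empty sets. *)
Definition sup_norm (V : Type) (N : V -> R) (h : R -> V) : \bar R :=
  ereal_sup [set (N (h t))%:E | t in `[0, 1]].

Definition incomplete_graph f : set ('rV[R]_d * R) :=
  [set p | 0 <= p.2 <= 1 /\ (p.1 = left_limit f p.2 \/ p.1 = f p.2)].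

Definition complete_graph f : set ('rV[R]_d * R) :=
  [set p | 0 <= p.2 <= 1 /\ segment (left_limit f p.2) (f p.2) p.1].

Definition graph_le f (p q : 'rV[R]_d * R) : Prop :=
  p.2 < q.2 \/
  p.2 = q.2 /\
    enorm (left_limit f p.2 - p.1) <= enorm (left_limit f q.2 - q.1).

(* (u, r) belongs to pi(complete_graph f) *)
Definition parametrization f u (r : R -> R) : Prop :=
  [/\ {within `[0, 1], continuous u},
      {within `[0, 1], continuous r},
      set_fun `[0, 1] `[0, 1] r,
      (forall s t : R, 0 <= s -> s <= t -> t <= 1 ->
         graph_le f (u s, r s) (u t, r t))
    & [set (u s, r s) | s in `[0, 1]] = complete_graph f].

Definition time_change (lambda : R -> R) : Prop :=
  {within `[0, 1], continuous lambda} /\ set_bij `[0, 1] `[0, 1] lambda.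

Definition thickening (B : set ('rV[R]_d * R)) (e : R) :
    set ('rV[R]_d * R) :=
  [set p | 0 <= p.2 <= 1 /\
     exists2 q, B q & Num.max (enorm (p.1 - q.1)) `|p.2 - q.2| <= e].

Definition hausdorff_dist (A B : set ('rV[R]_d * R)) : \bar R :=
  ereal_inf [set e%:E | e in
    [set e : R | [/\ 0 < e, A `<=` thickening B e & B `<=` thickening A e]]].

Definition dist_J1 f g : \bar R :=
  ereal_inf [set maxe (sup_norm enorm (f \o lambda \- g))
                      (sup_norm Num.norm (lambda \- id))
            | lambda in time_change].

Definition dist_M1 f g : \bar R :=
  ereal_inf [set v : \bar R | exists u1 r1 u2 r2,
    [/\ parametrization f u1 r1, parametrization g u2 r2
      & v = maxe (sup_norm enorm (u1 \- u2)) (sup_norm Num.norm (r1 \- r2))]].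

Definition dist_J2 f g : \bar R :=
  hausdorff_dist (incomplete_graph f) (incomplete_graph g).

Definition dist_M2 f g : \bar R :=
  hausdorff_dist (complete_graph f) (complete_graph g).

Inductive skorokhod_topology := J1 | J2 | M1 | M2.

Definition skorokhod_dist (T : skorokhod_topology) f g : \bar R :=
  match T with
  | J1 => dist_J1 f g
  | J2 => dist_J2 f g
  | M1 => dist_M1 f g
  | M2 => dist_M2 f g
  end.

Definition converges_in (T : skorokhod_topology) (f_ : nat -> R -> 'rV[R]_d) :
    Prop :=
  exists f, D01 f /\ (fun n => skorokhod_dist T (f_ n) f) @ \oo --> 0%E.

(* Only meaningful for n > 0 and t in [0,1]. *)
Definition step_embedding (n : nat) y (t : R) : 'rV[R]_d :=
  if t < 1 then y (Num.truncn (n%:R * t)) else y n.-1.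

Lemma step_embeddingE n y k t : (k < n)%N ->
  k%:R / n%:R <= t < k.+1%:R / n%:R -> step_embedding n y t = y k.
Proof.
move=> kn; have n0 : 0 < n%:R :> R by rewrite ltr0n (leq_ltn_trans _ kn).
rewrite ler_pdivrMr// ltr_pdivlMr// => /andP[lb ub].
rewrite /step_embedding ifT.
  by rewrite mulrC (@truncn_def _ _ k)// lb.
rewrite -(ltr_pM2r n0) mul1r (lt_le_trans ub)//.
by rewrite ler_nat.
Qed.

Lemma step_embedding1 n y : step_embedding n y 1 = y n.-1.
Proof. by rewrite /step_embedding ltxx. Qed.

Lemma D01_step_embedding n y : (0 < n)%N -> D01 (step_embedding n y).
Proof.
move=> n_gt0; have n0 : 0 < n%:R :> R by rewrite ltr0n.
have right_step (t : R) : 0 <= t < 1 ->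
    exists2 k, (k < n)%N & k%:R / n%:R <= t < k.+1%:R / n%:R.
  move=> /andP[t0 t1]; have tn0 : 0 <= t * n%:R by rewrite mulr_ge0.
  exists (Num.truncn (t * n%:R)).
    by rewrite truncn_lt_nat// gtr_pMl.
  by rewrite ler_pdivrMr// ltr_pdivlMr//; exact: truncn_itv.
have left_step (t : R) : 0 < t <= 1 ->
    exists2 k, (k < n)%N & k%:R / n%:R < t <= k.+1%:R / n%:R.
  move=> /andP[t0 t1].
  have tn0 : 0 < t * n%:R by rewrite mulr_gt0.
  have ex : exists m : nat, t * n%:R <= m%:R.
    by exists n; rewrite ler_piMl.
  case: (ex_minnP ex) => -[|k] kP kmin.
    by move: kP; rewrite leNgt tn0.
  exists k.
    by apply: kmin; rewrite ler_piMl.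
  rewrite ltr_pdivrMr// ler_pdivlMr// kP andbT ltNge.
  by apply/negP => /kmin; rewrite ltnn.
have left_cst (t : R) k : (k < n)%N -> k%:R / n%:R < t <= k.+1%:R / n%:R ->
    step_embedding n y @ t^'- --> y k.
  move=> kn /andP[kt tk]; apply: cvg_near_cst; near=> s.
  apply: (step_embeddingE _ kn); apply/andP; split.
    by near: s; exact: nbhs_left_ge.
  by rewrite (lt_le_trans _ tk).
split=> [t t01|t /left_step[k kn kt]|].
- have [k kn ktk] := right_step t t01; have /andP[kt tk] := ktk.
  rewrite (step_embeddingE y kn ktk); apply: cvg_near_cst; near=> s.
  apply: (step_embeddingE _ kn); apply/andP; split.
    by apply: (le_trans kt); apply: ltW.
  by near: s; exact: nbhs_right_lt.
- by apply: cvgP; exact: left_cst kn kt.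
- rewrite step_embedding1; apply: left_cst; rewrite prednK//.
  by rewrite divff ?gt_eqF// lexx andbT ltr_pdivrMr// mul1r ltr_nat prednK.
Unshelve. all: by end_near. Qed.

End Skorokhod.

(* Main.v *)
Require Import Defs.
From mathcomp Require Import all_boot all_order all_algebra.
From mathcomp Require Import all_classical all_reals all_analysis.
From mathcomp Require Import ring lra.

Set Implicit Arguments.
Unset Strict Implicit.
Unset Printing Implicit Defensive.

Import Order.TTheory GRing.Theory Num.Theory.
Import numFieldNormedType.Exports.

Local Open Scope classical_set_scope.
Local Open Scope ring_scope.

(** The theorem holds because the [J1] distance dominates the other three, at
    least at small scales: for [f], [g] in [D01] and [0 < e <= 1/2],
    [dist_J1 f g < e] implies [skorokhod_dist T f g <= e]
    ([skorokhod_dist_le_J1]).  The limit in [J1] is then the limit in [T], and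
    step functions enter only through [D01_step_embedding].

    A time change [lambda] that realizes [dist_J1 f g < e] is a continuous
    bijection of [[0, 1]] moving points by at most [1/2], hence an increasing
    one.  It carries left neighbourhoods to left neighbourhoods, so that
    [f (lambda t)] and [g t] are within [e] of each other and so are the left
    limits [f (lambda t -)] and [g (t -)] ([dist_J1_matching]).  Thus the fibre
    of either graph of [f] over [lambda t] is within [e] of the fibre of the
    graph of [g] over [t]; as [|lambda t - t| <= e], this bounds the two
    Hausdorff distances, [J2] and [M2].  Convexity of Euclidean balls takes
    care of the segments in complete graphs.

    For [M1] the two complete graphs have to be run through simultaneously.
    This is done by a clock ([clock]): to each time [t] is attached a slot
    [[a t, b t]] of parameters, slots are ordered like times and together cover
    [[0, 1]], and [r s] is the time whose slot contains [s].  If the slots of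
    the jump times of [g] are nondegenerate, [g] is parametrized by going
    linearly from [g (t -)] to [g t] during the slot of [t]
    ([clock_parametrization]).  These conditions involve the order of times
    only, so [lambda] transports the clock to one for [f]
    ([clock_time_change]); both parametrizations then use the same weights
    at each parameter, and stay within [e] of each other.

    A clock comes from the left and right limits of a strictly increasing
    function that jumps at all the prescribed times ([gauge_clock]).  That
    function is [t + Sg t + Sf (lambda t)], where [Sg] and [Sf] are sums of
    point masses at the jumps of [g] and [f] ([jump_gauge]); they exist because
    jumps are countably many ([jumps_code]). *)

(** * The Euclidean norm *)

Section EuclideanNorm.
Context {R : realType} {d : nat}.
Implicit Types (x y z : 'rV[R]_d).

Lemma enorm_ge0 z : 0 <= enorm z.
Proof. exact: sqrtr_ge0. Qed.

Lemma enorm_le z (e : R) : 0 <= e ->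
  (enorm z <= e) = (\sum_(i < d) z ord0 i ^+ 2 <= e ^+ 2).
Proof.
move=> e0; rewrite -[RHS]ler_sqrt ?exprn_ge0// sqrtr_sqr.
by rewrite ger0_norm.
Qed.

Lemma enormZ (a : R) z : 0 <= a -> enorm (a *: z) = a * enorm z.
Proof.
move=> a0; rewrite /enorm -[X in X * _](ger0_norm a0) -sqrtr_sqr.
rewrite -sqrtrM ?sqr_ge0// mulr_sumr; congr Num.sqrt.
by apply: eq_bigr => i _; rewrite mxE exprMn.
Qed.

(** Convexity of the square, coordinate by coordinate, makes the closed balls
    convex. *)
Lemma enorm_convex (a e : R) x y : 0 <= a <= 1 ->
  enorm x <= e -> enorm y <= e -> enorm (a *: x + (1 - a) *: y) <= e.
Proof.
move=> /andP[a0 a1] xe ye.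
have e0 : 0 <= e by rewrite (le_trans (enorm_ge0 x)).
rewrite !enorm_le// in xe ye *.
have -> : e ^+ 2 = a * e ^+ 2 + (1 - a) * e ^+ 2 by ring.
apply: (@le_trans _ _ (a * \sum_(i < d) x ord0 i ^+ 2 +
                       (1 - a) * \sum_(i < d) y ord0 i ^+ 2)); last first.
  by apply: lerD; apply: ler_wpM2l => //; rewrite subr_ge0.
rewrite !mulr_sumr -big_split/=; apply: ler_sum => i _; rewrite !mxE.
have := sqr_ge0 (x ord0 i - y ord0 i).
have : 0 <= a * (1 - a) by rewrite mulr_ge0// subr_ge0.
set u := x ord0 i; set v := y ord0 i => a2 uv.
rewrite -subr_ge0.
have -> : a * u ^+ 2 + (1 - a) * v ^+ 2 - (a * u + (1 - a) * v) ^+ 2 =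
  a * (1 - a) * (u - v) ^+ 2 by ring.
exact: mulr_ge0.
Qed.

Lemma enorm_continuous : continuous (@enorm R d).
Proof.
move=> z; rewrite /enorm.
apply: (continuous_comp (f := fun z : 'rV[R]_d => \sum_(i < d) z ord0 i ^+ 2)
  (g := Num.sqrt)); last exact: sqrt_continuous.
apply: (@cvg_big _ _ +%R 0 _ add_continuous _ _ _ _ _ (nbhs_filter z)) => i _.
rewrite [X in X @ _](_ : _ = (fun u : 'rV[R]_d => u ord0 i * u ord0 i)).
  by rewrite expr2; apply: cvgM; exact: coord_continuous.
by apply/funext => u; rewrite expr2.
Qed.

Lemma enorm_cvg_le {I : Type} (F : set_system I) {FF : ProperFilter F}
    (h : I -> 'rV[R]_d) z (e : R) :
  h @ F --> z -> (\forall s \near F, enorm (h s) <= e) -> enorm z <= e.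
Proof.
move=> hz he.
have hn : (enorm \o h) @ F --> enorm z.
  by apply: continuous_cvg hz; exact: enorm_continuous.
exact: (cvgr_to_le hn he).
Qed.

End EuclideanNorm.

(** * One-sided limits *)

Section OneSidedLimits.
Context {R : realType} {d : nat}.
Implicit Types (f : R -> 'rV[R]_d) (s t e : R).

Lemma left_limit0 f : left_limit f 0 = f 0.
Proof. by rewrite /left_limit lexx. Qed.

Lemma cvg_left_limit f t : D01 f -> 0 < t <= 1 ->
  f @ t^'- --> left_limit f t.
Proof.
by move=> [_ fl _] t01; rewrite /left_limit leNgt; case/andP: (t01) => -> _;
  exact: fl.
Qed.

Lemma left_limit1 f : D01 f -> left_limit f 1 = f 1.
Proof.
move=> Df; have [_ _ f1] := Df; rewrite /left_limit ler10.
exact: cvg_lim.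
Qed.

Lemma norm_cvg_le {I : Type} (F : set_system I) {FF : ProperFilter F}
    (h : I -> 'rV[R]_d) (z c : 'rV[R]_d) e :
  h @ F --> z -> (\forall i \near F, `|h i - c| <= e) -> `|z - c| <= e.
Proof.
move=> hz he.
have hn : (fun i => `|h i - c|) @ F --> `|z - c|.
  by apply: cvg_norm; apply: cvgB => //; exact: cvg_cst.
exact: (cvgr_to_le hn he).
Qed.

(** The left limit at a later time is a limit of values of [f] between [t] and
    that time, so it is as close to [f t] as those values are. *)
Lemma near_right f t e : D01 f -> 0 <= t < 1 -> 0 < e ->
  exists t1, [/\ t < t1, t1 <= 1 & forall s, t < s < t1 ->
    `|f s - f t| <= e /\ `|left_limit f s - f t| <= e].
Proof.
move=> Df t01 e0; have [fr _ _] := Df; have /andP[t0 t1] := t01.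
have [eta /= eta0 etaP] := (cvgrPdist_le _ _).1 (fr t t01) _ e0.
have fs s : t < s < t + eta -> `|f s - f t| <= e.
  move=> /andP[ts se]; rewrite distrC; apply: etaP => //=.
  by rewrite ltr_norml; lra.
exists (Num.min 1 (t + eta)); split.
- by rewrite lt_min t1 ltrDl.
- by rewrite ge_min lexx.
move=> s /andP[ts]; rewrite lt_min => /andP[s1 se].
split; first by rewrite fs// ts.
apply: (@norm_cvg_le _ s^'- _ f); first by apply: cvg_left_limit => //; lra.
near=> w; apply: fs; apply/andP; split.
  by near: w; exact: nbhs_left_gt.
by apply: lt_trans se; near: w; exact: nbhs_left_lt.
Unshelve. all: by end_near. Qed.

Lemma near_left f t e : D01 f -> 0 < t <= 1 -> 0 < e ->
  exists t1, [/\ 0 <= t1, t1 < t & forall s, t1 < s < t ->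
    `|f s - left_limit f t| <= e /\
    `|left_limit f s - left_limit f t| <= e].
Proof.
move=> Df t01 e0; have /andP[t0 t1] := t01.
have [eta /= eta0 etaP] :=
  (cvgrPdist_le _ _).1 (cvg_left_limit Df t01) _ e0.
have fs s : t - eta < s < t -> `|f s - left_limit f t| <= e.
  move=> /andP[ts se]; rewrite distrC; apply: etaP => //=.
  by rewrite ltr_norml; lra.
exists (Num.max 0 (t - eta)); split.
- by rewrite le_max lexx.
- by rewrite gt_max t0 gtrBl.
move=> s /andP[]; rewrite gt_max => /andP[s0 se] st.
split; first by rewrite fs// se.
apply: (@norm_cvg_le _ s^'- _ f); first by apply: cvg_left_limit => //; lra.
near=> w; apply: fs; apply/andP; split.
  by near: w; exact: nbhs_left_gt.
by apply: lt_trans st; near: w; exact: nbhs_left_lt.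
Unshelve. all: by end_near. Qed.

End OneSidedLimits.

(** * Increasing time changes *)

Section TimeChange.
Context {R : realType}.
Implicit Types (lambda mu : R -> R) (s t : R).

(** An increasing time change together with its inverse; an order isomorphism
    of [[0, 1]] is automatically continuous. *)
Definition unit_iso lambda mu : Prop :=
  [/\ forall t, 0 <= t <= 1 -> 0 <= lambda t <= 1,
      forall t, 0 <= t <= 1 -> 0 <= mu t <= 1,
      forall t, 0 <= t <= 1 -> lambda (mu t) = t,
      forall t, 0 <= t <= 1 -> mu (lambda t) = t
    & forall s t, 0 <= s <= 1 -> 0 <= t <= 1 ->
        (lambda s < lambda t) = (s < t)].

Lemma unit_iso_sym lambda mu : unit_iso lambda mu -> unit_iso mu lambda.
Proof.
move=> [l01 m01 lK mK lmono]; split=> // s t s01 t01.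
by rewrite -[in RHS](lK s)// -[in RHS](lK t)// lmono ?m01.
Qed.

Lemma unit_iso0 lambda mu : unit_iso lambda mu -> lambda 0 = 0.
Proof.
move=> [l01 m01 lK mK lmono].
have i0 : 0 <= (0 : R) <= 1 by rewrite lexx ler01.
apply/eqP; rewrite eq_le; have /andP[-> _] := l01 _ i0; rewrite andbT.
rewrite -[leRHS](lK 0)// leNgt lmono ?m01// -leNgt.
by have /andP[] := m01 _ i0.
Qed.

(** A continuous injection of an interval is monotone, and its values at the
    end points decide the direction. *)
Lemma time_change_unit_iso lambda : time_change lambda ->
  lambda 0 < lambda 1 -> exists mu, unit_iso lambda mu.
Proof.
move=> [lc [lf linj lsurj]] l01.
have in01 t : 0 <= t <= 1 -> t \in `[0, 1]%R by rewrite in_itv.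
have lmono : {in `[0, 1]%R &, {mono lambda : x y / x <= y}}.
  apply: itv_continuous_inj_le => //.
  - exists 0, 1; split; rewrite ?in_itv/= ?lexx ?ler01 ?ltr01//; exact: ltW.
  - move=> x y xI yI; apply: linj; exact: mem_set.
have /choice[mu muP] : forall t : R, exists s,
    0 <= t <= 1 -> 0 <= s <= 1 /\ lambda s = t.
  move=> t; case: (boolP (0 <= t <= 1)) => [t01|]; last by exists 0.
  have [|s /= sI <-] := lsurj t; first by rewrite /= in_itv.
  by exists s => _; split=> //; move: sI; rewrite in_itv.
exists mu; split.
- by move=> t t01; have := lf t; rewrite /= !in_itv/=; exact.
- by move=> t /muP[].
- by move=> t /muP[].
- move=> t t01.
  have lt01 : 0 <= lambda t <= 1.
    by have := lf t; rewrite /= !in_itv/=; exact.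
  have [m01 meq] := muP _ lt01.
  by apply: linj; rewrite ?meq//; apply/mem_set; rewrite /= in_itv.
- move=> s t s01 t01; rewrite !ltNge; congr negb.
  exact: lmono (in01 _ t01) (in01 _ s01).
Qed.

End TimeChange.

Section J1Matching.
Context {R : realType} {d : nat}.
Implicit Types (f g : R -> 'rV[R]_d) (lambda mu : R -> R) (e s t : R).

Definition J1_matching f g lambda mu e : Prop :=
  [/\ unit_iso lambda mu,
      forall t, 0 <= t <= 1 -> enorm (f (lambda t) - g t) <= e,
      forall t, 0 <= t <= 1 ->
        enorm (left_limit f (lambda t) - left_limit g t) <= e
    & forall t, 0 <= t <= 1 -> `|lambda t - t| <= e].

(** A time change is an order isomorphism, so it carries the left
    neighbourhoods of a time to those of its image. *)
Lemma cvg_left_time_change f lambda mu t : D01 f -> time_change lambda ->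
  unit_iso lambda mu -> 0 < t <= 1 ->
  (f \o lambda) @ t^'- --> left_limit f (lambda t).
Proof.
move=> Df [lc _] iso t01; have [l01 m01 lK mK lmono] := iso.
have /andP[t0 t1] := t01.
have tI : 0 <= t <= 1 by rewrite ltW.
have I0 : 0 <= (0 : R) <= 1 by rewrite lexx ler01.
have lt0 : 0 < lambda t by rewrite -[X in X < _](unit_iso0 iso) lmono.
have fl : f @ (lambda t)^'- --> left_limit f (lambda t).
  by apply: cvg_left_limit => //; rewrite lt0; case/andP: (l01 _ tI).
apply: cvg_comp fl => A [e /= e0 eA].
have [lt_ _ lt1] := (continuous_within_itvP lambda ltr01).1 lc.
have ltl : lambda @ t^'- --> lambda t.
  move: t1; rewrite le_eqVlt => /orP[/eqP ->//|t1].
  by apply: cvg_at_left_filter; apply: lt_; rewrite in_itv/= t0.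
near=> s; apply: eA => /=.
  by near: s; exact: (cvgrPdist_lt _ _).1 ltl _ e0.
have s_lt : s < t by near: s; exact: nbhs_left_lt.
have s_ge : 0 <= s by near: s; exact: nbhs_left_ge.
by rewrite lmono// s_ge (le_trans (ltW s_lt)).
Unshelve. all: by end_near. Qed.

(** At scale at most [1/2] a time change cannot exchange the end points, so
    it is increasing; the bound at left limits follows from the bound at the
    neighbouring points. *)
Lemma dist_J1_matching f g e : D01 f -> D01 g -> e <= 2^-1 ->
  (dist_J1 f g < e%:E)%E -> exists lambda mu, J1_matching f g lambda mu e.
Proof.
move=> Df Dg e2 /ereal_inf_lt[_ [lambda tc <-]].
rewrite gt_max => /andP[fe le].
have I t : 0 <= t <= 1 -> `[0, 1]%classic t by rewrite /= in_itv.
have I0 : 0 <= (0 : R) <= 1 by rewrite lexx ler01.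
have I1 : 0 <= (1 : R) <= 1 by rewrite lexx ler01.
have fe_ t : 0 <= t <= 1 -> enorm (f (lambda t) - g t) <= e.
  move=> /I tI; rewrite -lee_fin; apply: le_trans (ltW fe).
  by apply: ereal_sup_ubound; exists t.
have le_ t : 0 <= t <= 1 -> `|lambda t - t| < e.
  move=> /I tI; rewrite -lte_fin; apply: le_lt_trans le.
  by apply: ereal_sup_ubound; exists t.
have l01 : lambda 0 < lambda 1.
  have := le_ 0 I0; have := le_ 1 I1; rewrite !ltr_norml; lra.
have [mu iso] := time_change_unit_iso tc l01.
exists lambda, mu; split=> // [t t01|t /le_ /ltW//].
have /andP[] := t01; rewrite le_eqVlt => /orP[/eqP <- _|t0 t1].
  by rewrite (unit_iso0 iso) !left_limit0 -[X in f X](unit_iso0 iso) fe_.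
have t01' : 0 < t <= 1 by rewrite t0.
have h : (fun s => f (lambda s) - g s) @ t^'- -->
    left_limit f (lambda t) - left_limit g t.
  apply: cvgB; last exact: cvg_left_limit.
  exact: (cvg_left_time_change Df tc iso).
apply: (enorm_cvg_le h); near=> s; apply: fe_.
rewrite (le_trans _ t1) ?andbT.
  by near: s; exact: nbhs_left_ge.
by apply: ltW; near: s; exact: nbhs_left_lt.
Unshelve. all: by end_near. Qed.

End J1Matching.

(** * Jumps *)

Section Jumps.
Context {R : realType} {d : nat}.
Implicit Types (f : R -> 'rV[R]_d) (s t : R).

Definition jumps f : set R :=
  [set t | 0 <= t <= 1 /\ left_limit f t <> f t].

Lemma jumps_itvoo f t : D01 f -> jumps f t -> 0 < t < 1.
Proof.
move=> Df [/andP[t0 t1] ft].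
move: t0; rewrite le_eqVlt => /orP[/eqP t0|->/=].
  by exfalso; apply: ft; rewrite -t0 left_limit0.
move: t1; rewrite le_eqVlt => /orP[/eqP t1|//].
by exfalso; apply: ft; rewrite t1 (left_limit1 Df).
Qed.

(** Jumps are countable: a jump [t] of size above [1/(m+1)] is followed by an
    interval [(t, q)], with [q] rational, that has no jump of that size, and
    then the pair [(m, q)] determines [t]. *)
Lemma jumps_code f : D01 f -> exists code : R -> nat, forall s t,
  jumps f s -> jumps f t -> code s = code t -> s = t.
Proof.
move=> Df.
pose size_ t := `|left_limit f t - f t|.
have /choice[c cP] : forall t, exists c : nat * rat, jumps f t ->
    [/\ c.1.+1%:R^-1 < size_ t, t < ratr c.2
      & forall s, t < s < ratr c.2 -> size_ s <= c.1.+1%:R^-1].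
  move=> t; case: (pselect (jumps f t)) => [jt|]; last by exists (0%N, 0%R).
  have /andP[t0 t1] := jumps_itvoo Df jt; have [_ ft] := jt.
  have sz0 : 0 < size_ t.
    by rewrite /size_ normr_gt0 subr_eq0; apply/eqP.
  (* [m + 1] exceeds the inverse of the size of the jump. *)
  pose m := Num.truncn (size_ t)^-1.
  have mP : m.+1%:R^-1 < size_ t.
    rewrite -[ltRHS]invrK ltf_pV2 ?posrE ?invr_gt0 ?ltr0n//.
    exact: truncnS_gt.
  have e0 : 0 < (m.+1%:R^-1 / 2 : R) by rewrite divr_gt0// invr_gt0 ltr0n.
  have t01 : 0 <= t < 1 by rewrite ltW.
  have [t2 [tt2 t21 t2P]] := near_right Df t01 e0.
  have [q] := rat_in_itvoo tt2; rewrite in_itv/= => /andP[tq qt2].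
  exists (m, q) => _; split=> // s /andP[ts sq] /=.
  have [|f1 f2] := t2P s; first by rewrite ts (lt_trans sq).
  rewrite /size_ [leRHS]splitr.
  have -> : left_limit f s - f s = (left_limit f s - f t) - (f s - f t).
    by rewrite opprB addrA subrK.
  by rewrite (le_trans (ler_normB _ _))// lerD.
exists (pickle \o c) => s t js jt /= /(pcan_inj pickleK) cst.
have [cs1 cs2 cs3] := cP s js; have [ct1 ct2 ct3] := cP t jt.
have [st|ts|//] := ltgtP s t.
- have : size_ t <= (c s).1.+1%:R^-1 by rewrite cs3// st cst.
  by rewrite leNgt cst ct1.
- have : size_ s <= (c t).1.+1%:R^-1 by rewrite ct3// ts -cst.
  by rewrite leNgt -cst cs1.
Qed.

(** For monotone [S] and [0 < p <= 1], this says without limits that [S] is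
    not left continuous at [p]. *)
Definition gap (S : R -> R) (p : R) : Prop := exists2 c, 0 < c &
  forall s t, 0 <= s -> s < p -> p <= t -> t <= 1 -> S s + c <= S t.

(** Put a mass [2^-(k+1)] at the jump with code [k]; the gauge at [t] is the
    total mass of the jumps up to [t]. *)
Lemma jump_gauge f : D01 f -> exists S : R -> R,
  {homo S : s t / s <= t} /\ forall p, jumps f p -> gap S p.
Proof.
move=> Df; have [code codeP] := jumps_code Df.
pose seen (t : R) (k : nat) := `[< exists p, [/\ jumps f p, p <= t & code p = k] >].
pose w (k : nat) : R := geometric 2^-1 2^-1 k.
have w0 k : 0 < w k by rewrite /w /= mulr_gt0// exprn_gt0.
pose u t k : R := (seen t k)%:R * w k.
have u0 t k : 0 <= u t k by rewrite mulr_ge0// ltW.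
have ucvg t : cvgn (series (u t)).
  apply: (@series_le_cvg _ _ w) => //.
  - by move=> k; exact: ltW.
  - by move=> k; rewrite /u ler_piMl ?(ltW (w0 _))//; case: (seen t k).
  - by apply: is_cvg_geometric_series; rewrite ger0_norm// invf_lt1// ltr1n.
have seen_le s t k : s <= t -> seen s k -> seen t k.
  move=> st /asboolP[p [jp ps ck]]; apply/asboolP; exists p; split=> //.
  exact: le_trans ps st.
have u_le s t k : s <= t -> u s k <= u t k.
  move=> st; rewrite ler_pM2r// ler_nat.
  by move: (@seen_le s t k st); case: (seen s k) => // ->.
exists (fun t => limn (series (u t))); split=> [s t st|p jp].
  apply: ler_lim => //; near=> n.
  by apply: ler_sum => k _; exact: u_le.
exists (w (code p)) => // s t _ sp pt _.
rewrite -lerBrDr; apply: limr_le => //; near=> n.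
rewrite lerBrDr; apply: (@le_trans _ _ (series (u t) n)); last first.
  apply: nondecreasing_cvgn_le => //.
  apply/nondecreasing_seqP => m; rewrite /series/= big_nat_recr//=.
  by rewrite lerDl.
have cn : (code p < n)%N by near: n; exact: nbhs_infty_gt.
rewrite /series/= !big_mkord.
rewrite (bigD1 (Ordinal cn))//= [leRHS](bigD1 (Ordinal cn))//=.
rewrite addrAC lerD//.
  have -> : u t (code p) = w (code p).
    rewrite /u (_ : seen t (code p) = true) ?mul1r//.
    by apply/asboolP; exists p.
  have -> : u s (code p) = 0.
    rewrite /u (_ : seen s (code p) = false) ?mul0r//.
    apply/asboolPn => -[q [jq qs cq]].
    have qp := codeP _ _ jq jp cq.
    by move: sp; rewrite -qp ltNge qs.
  by rewrite add0r.
by apply: ler_sum => k _; apply: u_le; apply: ltW; exact: lt_le_trans sp pt.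
Unshelve. all: by end_near. Qed.

End Jumps.

(** * Clocks *)

Section Clock.
Context {R : realType}.
Implicit Types (a b r S : R -> R) (s t p : R).

(** The slot [[a t, b t]] is the set of parameters spent at time [t]; [r] reads
    the time off a parameter.  That the slots cover [[0, 1]] in the order of
    times is enough to make [r] continuous. *)
Definition clock a b r : Prop :=
  [/\ forall t, 0 <= t <= 1 -> [/\ 0 <= a t, a t <= b t & b t <= 1],
      forall s t, 0 <= s -> s < t -> t <= 1 -> b s < a t,
      forall s, 0 <= s <= 1 -> 0 <= r s <= 1
    & forall s, 0 <= s <= 1 -> a (r s) <= s <= b (r s)].

(** With [N] the gauge normalized to go from [0] to [1], [a] and [b] are its
    left and right limits and [r] its generalized inverse.  Strict
    monotonicity separates the slots, since two more values of [N] fit between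
    two times. *)
Lemma gauge_clock S :
  (forall s t, 0 <= s -> s < t -> t <= 1 -> S s < S t) ->
  exists a b r, clock a b r /\ forall p, 0 < p <= 1 -> gap S p -> a p < b p.
Proof.
move=> Slt.
have S01 : 0 < S 1 - S 0 by rewrite subr_gt0 Slt.
pose N t := (S t - S 0) / (S 1 - S 0).
have N0 : N 0 = 0 by rewrite /N subrr mul0r.
have N1 : N 1 = 1 by rewrite /N divff// gt_eqF.
have Nlt s t : 0 <= s -> s < t -> t <= 1 -> N s < N t.
  by move=> s0 st t1; rewrite /N ltr_pM2r ?invr_gt0// ltrD2r Slt.
have Nle s t : 0 <= s -> s <= t -> t <= 1 -> N s <= N t.
  by move=> s0; rewrite le_eqVlt => /orP[/eqP ->//|st t1]; apply/ltW/Nlt.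
(* The values 0 and 1 settle the slots of the end points, where [N] has no
   values on one side. *)
pose A t := [set x | x = 0 \/ exists2 s, 0 <= s < t & x = N s].
pose B t := [set x | x = 1 \/ exists2 s, t < s <= 1 & x = N s].
pose C s := [set t | 0 <= t <= 1 /\ N t <= s].
have Aub t : 0 <= t <= 1 -> ubound (A t) (N t).
  move=> /andP[t0 t1] x [->|[s /andP[s0 st] ->]]; first by rewrite -N0 Nle.
  by rewrite Nle// ltW.
have Blb t : 0 <= t <= 1 -> lbound (B t) (N t).
  move=> /andP[t0 t1] x [->|[s /andP[ts s1] ->]]; first by rewrite -N1 Nle.
  by rewrite Nle// ltW.
have An0 t : A t !=set0 by exists 0; left.
have Bn0 t : B t !=set0 by exists 1; left.
have leA t x : 0 <= t <= 1 -> A t x -> x <= sup (A t).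
  by move=> t01; apply: ub_le_sup; exists (N t); exact: Aub.
have geB t x : 0 <= t <= 1 -> B t x -> inf (B t) <= x.
  by move=> t01; apply: ge_inf; exists (N t); exact: Blb.
have leC s t : C s t -> t <= sup (C s).
  by apply: ub_le_sup; exists 1 => ? [/andP[]].
have C0 s : 0 <= s -> C s 0 by move=> s0; split; rewrite ?lexx ?ler01 ?N0.
exists (fun t => sup (A t)), (fun t => inf (B t)), (fun s => sup (C s)).
have rI s : 0 <= s <= 1 -> 0 <= sup (C s) <= 1.
  move=> /andP[s0 s1]; rewrite leC; last exact: C0.
  by apply: ge_sup; [exists 0; exact: C0|move=> ? [/andP[]]].
split; first split=> //.
- move=> t t01; split; first by apply: leA => //; left.
    apply: (@le_trans _ _ (N t)); first by apply: ge_sup => //; exact: Aub.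
    by apply: lb_le_inf => //; exact: Blb.
  by apply: geB => //; left.
- move=> s t s0 st t1.
  pose m1 := s + (t - s) / 3; pose m2 := s + (t - s) / 3 *+ 2.
  have sm1 : s < m1 by rewrite /m1; lra.
  have m12 : m1 < m2 by rewrite /m1 /m2; lra.
  have m2t : m2 < t by rewrite /m2; lra.
  apply: (@le_lt_trans _ _ (N m1)).
    by apply: geB; [lra|right; exists m1 => //; lra].
  apply: (@lt_le_trans _ _ (N m2)); first by apply: Nlt; lra.
  by apply: leA; [lra|right; exists m2 => //; lra].
- move=> s s01; have /andP[s0 s1] := s01; have /andP[r0 r1] := rI s s01.
  apply/andP; split.
    apply: ge_sup => // x [->//|[t /andP[t0 tr] ->]].
    have [||t' [/andP[t'0 t'1] t's]] := @sup_adherent _ (C s) (sup (C s) - t).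
    + by rewrite subr_gt0.
    + by split; [exists 0; exact: C0|exists 1 => ? [/andP[]]].
    rewrite subKr => tt'; apply: le_trans t's; apply: Nle => //; exact: ltW.
  apply: lb_le_inf => // x [->//|[t /andP[rt t1] ->]].
  rewrite leNgt; apply/negP => Nts.
  move: (rt); rewrite ltNge => /negP; apply; apply: leC; split; last exact: ltW.
  by rewrite t1 andbT (le_trans r0)// ltW.
- move=> p /andP[p0 p1] [c c0 cP].
  pose c' := c / (S 1 - S 0).
  have c'0 : 0 < c' by rewrite divr_gt0.
  have Ngap s t : 0 <= s -> s < p -> p <= t -> t <= 1 -> N s + c' <= N t.
    move=> s0 sp pt t1; rewrite /N /c' -mulrDl ler_pM2r ?invr_gt0//.
    by have := cP s t s0 sp pt t1; lra.
  rewrite -subr_gt0 (lt_le_trans c'0)// lerBrDr addrC -lerBrDr.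
  apply: ge_sup => // x Ax; rewrite lerBrDr; apply: lb_le_inf => // y By.
  have [s [/andP[s0 sp] ->]] : exists s, 0 <= s < p /\ x = N s.
    by case: Ax => [->|[s ? ->]]; [exists 0; rewrite lexx p0|exists s].
  have [t [/andP[pt t1] ->]] : exists t, p <= t <= 1 /\ y = N t.
    case: By => [->|[t /andP[pt t1] ->]]; first by exists 1; rewrite p1 lexx.
    by exists t; rewrite (ltW pt).
  exact: Ngap.
Qed.

End Clock.

(** * Parametrizing a complete graph by a clock *)

Lemma unit_continuous {R : realType} (V : pseudoMetricNormedZmodType R)
    (h : R -> V) :
  (forall s e : R, 0 <= s <= 1 -> 0 < e ->
    \forall x \near within `[0, 1] (nbhs s), `|h s - h x| <= e) ->
  {within `[0, 1], continuous h}.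
Proof.
move=> hP; apply/subspace_continuousP => s; rewrite /= in_itv/= => sI.
by apply/cvgrPdist_le => e e0; exact: hP.
Qed.

Section ClockParametrization.
Context {R : realType} {d : nat}.
Implicit Types (f : R -> 'rV[R]_d) (a b r : R -> R) (s t e : R).

(** The share of the slot of [r s] that is left after [s].  On a one-point slot
    it is [0], because the inverse of [0] is [0], and [blend] is then [f (r s)]. *)
Definition weight a b r s : R := (b (r s) - s) / (b (r s) - a (r s)).

Definition blend f a b r s : 'rV[R]_d :=
  weight a b r s *: left_limit f (r s) + (1 - weight a b r s) *: f (r s).

Section Order.
Variables (a b r : R -> R).
Hypothesis abr : clock a b r.

Lemma clock_lt s t : 0 <= s <= 1 -> 0 <= t <= 1 -> s < a t -> r s < t.
Proof.
case: abr => ab lt rI rP sI tI sat; rewrite ltNge; apply/negP => trs.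
have /andP[rs1 rs2] := rP _ sI; have /andP[t0 t1] := tI.
have [_ abt _] := ab _ tI; have /andP[r0 r1] := rI _ sI.
move: trs; rewrite le_eqVlt => /orP[/eqP trs|trs].
  by move: rs1; rewrite -trs leNgt sat.
by have := lt _ _ t0 trs r1; lra.
Qed.

Lemma clock_gt s t : 0 <= s <= 1 -> 0 <= t <= 1 -> b t < s -> t < r s.
Proof.
case: abr => ab lt rI rP sI tI sbt; rewrite ltNge; apply/negP => trs.
have /andP[rs1 rs2] := rP _ sI; have /andP[t0 t1] := tI.
have [_ abt _] := ab _ tI; have /andP[r0 r1] := rI _ sI.
move: trs; rewrite le_eqVlt => /orP[/eqP trs|trs].
  by move: rs2; rewrite trs leNgt sbt.
by have := lt _ _ r0 trs t1; lra.
Qed.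

Lemma clock_eq s t : 0 <= s <= 1 -> 0 <= t <= 1 -> a t <= s <= b t -> r s = t.
Proof.
case: abr => ab lt rI rP sI tI /andP[as_ sb].
have /andP[rs1 rs2] := rP _ sI; have /andP[t0 t1] := tI.
have /andP[r0 r1] := rI _ sI.
have [st|ts|//] := ltgtP (r s) t.
- by have := lt _ _ r0 st t1; lra.
- by have := lt _ _ t0 ts r1; lra.
Qed.

Lemma clock_homo s t : 0 <= s -> s <= t -> t <= 1 -> r s <= r t.
Proof.
case: abr => ab lt rI rP s0 st t1.
have sI : 0 <= s <= 1 by rewrite s0 (le_trans st).
have tI : 0 <= t <= 1 by rewrite t1 (le_trans s0).
have /andP[rs1 rs2] := rP _ sI; have /andP[rt1 rt2] := rP _ tI.
have /andP[r0 _] := rI _ tI; have /andP[_ r1] := rI _ sI.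
rewrite leNgt; apply/negP => rts; have := lt _ _ r0 rts r1; lra.
Qed.

Lemma weight01 s : 0 <= s <= 1 -> 0 <= weight a b r s <= 1.
Proof.
case: abr => _ _ _ rP sI; have /andP[rs1 rs2] := rP _ sI; rewrite /weight.
have [->|ab] := eqVneq (a (r s)) (b (r s)).
  by rewrite subrr invr0 mulr0 lexx ler01.
have ab0 : 0 < b (r s) - a (r s) by rewrite subr_gt0 lt_neqAle ab (le_trans rs1).
by rewrite divr_ge0 ?subr_ge0// ?(le_trans rs1)//= ler_pdivrMr// mul1r; lra.
Qed.

Lemma near_clock_lt s t : 0 <= s <= 1 -> r s < t -> t <= 1 ->
  \forall x \near within `[0, 1] (nbhs s), r x < t.
Proof.
case: abr => ab lt rI rP sI st t1.
have /andP[rs1 rs2] := rP _ sI; have /andP[r0 r1] := rI _ sI.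
have sat : s < a t by apply: le_lt_trans rs2 _; exact: lt.
rewrite near_withinE; near=> x => /=; rewrite in_itv/= => xI.
apply: clock_lt => //; first by rewrite t1 (le_trans r0)// ltW.
by near: x; exact: lt_nbhsl.
Unshelve. all: by end_near. Qed.

Lemma near_clock_gt s t : 0 <= s <= 1 -> 0 <= t -> t < r s ->
  \forall x \near within `[0, 1] (nbhs s), t < r x.
Proof.
case: abr => ab lt rI rP sI t0 st.
have /andP[rs1 rs2] := rP _ sI; have /andP[r0 r1] := rI _ sI.
have sat : b t < s by apply: lt_le_trans _ rs1; exact: lt.
rewrite near_withinE; near=> x => /=; rewrite in_itv/= => xI.
apply: clock_gt => //; first by rewrite t0 (le_trans _ r1)// ltW.
by near: x; exact: lt_nbhsr.
Unshelve. all: by end_near. Qed.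

Lemma clock_continuous : {within `[0, 1], continuous r}.
Proof.
case: abr => ab lt rI rP.
apply: unit_continuous => s e sI e0; have /andP[r0 r1] := rI _ sI.
have h1 : \forall x \near within `[0, 1] (nbhs s), r x <= r s + e.
  have [e1|e1] := leP (r s + e) 1.
    have : r s < r s + e by rewrite ltrDl.
    move=> /(near_clock_lt sI) /(_ e1); apply: filterS => x; exact: ltW.
  rewrite near_withinE; near=> x => /=; rewrite in_itv/= => xI.
  by apply: le_trans (ltW e1); case/andP: (rI _ xI).
have h2 : \forall x \near within `[0, 1] (nbhs s), r s - e <= r x.
  have [e1|e1] := leP 0 (r s - e).
    have : r s - e < r s by rewrite gtrBl.
    move=> /(near_clock_gt sI e1); apply: filterS => x; exact: ltW.
  rewrite near_withinE; near=> x => /=; rewrite in_itv/= => xI.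
  by apply: le_trans (ltW e1) _; case/andP: (rI _ xI).
apply: filterS2 h1 h2 => x /= x1 x2; rewrite ler_norml; lra.
Unshelve. all: by end_near. Qed.

End Order.

Lemma norm_convex_dist (al e : R) (x y c : 'rV[R]_d) : 0 <= al <= 1 ->
  `|x - c| <= e -> `|y - c| <= e -> `|al *: x + (1 - al) *: y - c| <= e.
Proof.
move=> /andP[al0 al1] xe ye.
have -> : al *: x + (1 - al) *: y - c = al *: (x - c) + (1 - al) *: (y - c).
  by rewrite !scalerBr addrACA -opprD -scalerDl (addrC al) subrK scale1r.
rewrite (le_trans (ler_normD _ _))// !normrZ (ger0_norm al0).
rewrite (@ger0_norm _ (1 - al)) ?subr_ge0//.
have -> : e = al * e + (1 - al) * e by ring.
by apply: lerD; apply: ler_wpM2l; rewrite ?subr_ge0.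
Qed.

(** Continuity at [s]: inside the slot of [r s] the parametrization is affine.
    Parameters above [s] whose time is later occur near [s] only when [s] is
    the end of its slot; there the value is [f (r s)], which is the limit of
    [f] and of its left limits from the right.  Symmetrically, at the start of
    the slot the value is the left limit.  A one-point slot is both at once,
    and there the two values agree for lack of a jump. *)
Lemma clock_parametrization f a b r : D01 f -> clock a b r ->
  (forall t, jumps f t -> a t < b t) -> parametrization f (blend f a b r) r.
Proof.
move=> Df abr fab; have [ab lt rI rP] := abr.
have noj t : 0 <= t <= 1 -> a t = b t -> left_limit f t = f t.
  move=> tI abt; apply: contrapT => ft.
  by have := fab t (conj tI ft); rewrite abt ltxx.
have blendb s : b (r s) = s -> blend f a b r s = f (r s).
  by move=> bs; rewrite /blend /weight bs subrr mul0r scale0r subr0 scale1r add0r.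
have blenda s : 0 <= s <= 1 -> a (r s) = s ->
    blend f a b r s = left_limit f (r s).
  move=> sI as_; have [bs|bs] := eqVneq (b (r s)) s.
    by rewrite blendb// noj ?rI// as_ bs.
  rewrite /blend /weight as_ divff ?subr_eq0//.
  by rewrite scale1r subrr scale0r addr0.
split.
- apply: unit_continuous => s e sI e0.
  have /andP[rs0 rs1] := rI _ sI; have /andP[ars brs] := rP _ sI.
  have [_ abrs _] := ab _ (rI _ sI).
  have inI : \forall x \near within `[0, 1] (nbhs s), 0 <= x <= 1.
    by rewrite near_withinE; near=> x => /=; rewrite in_itv.
  (* [K] is the speed at which the segment at time [r s] is run through. *)
  have stay : \forall x \near within `[0, 1] (nbhs s), r x = r s ->
      `|blend f a b r s - blend f a b r x| <= e.
    pose K := (b (r s) - a (r s))^-1 * `|left_limit f (r s) - f (r s)|.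
    have K0 : 0 <= K by rewrite mulr_ge0// invr_ge0 subr_ge0.
    have eK : 0 < e / (K + 1) by rewrite divr_gt0// ltr_wpDl.
    rewrite near_withinE; near=> x => _.
    have xs : `|s - x| <= e / (K + 1) by near: x; exact: cvgr_dist_le.
    move=> rx.
    have -> : blend f a b r s - blend f a b r x =
        ((x - s) / (b (r s) - a (r s))) *: (left_limit f (r s) - f (r s)).
      have -> : (x - s) / (b (r s) - a (r s)) =
          weight a b r s - weight a b r x.
        by rewrite /weight rx -mulrBl; congr (_ / _); ring.
      rewrite /blend rx; move: (weight a b r s) (weight a b r x) => al be.
      move: (left_limit f (r s)) (f (r s)) => L V.
      by apply/rowP => i; rewrite !mxE; ring.
    rewrite normrZ normrM (@ger0_norm _ _^-1) ?invr_ge0 ?subr_ge0// -mulrA.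
    rewrite -/K; apply: (@le_trans _ _ (`|s - x| * (K + 1))).
      by rewrite distrC ler_wpM2l// lerDl.
    by rewrite -ler_pdivlMr ?ltr_wpDl.
  have right : \forall x \near within `[0, 1] (nbhs s), r s < r x ->
      `|blend f a b r s - blend f a b r x| <= e.
    move: brs; rewrite le_eqVlt => /orP[/eqP brs|brs]; last first.
      rewrite near_withinE; near=> x => /=; rewrite in_itv/= => xI rx.
      have /andP[rx0 rx1] := rI _ xI; have /andP[arx _] := rP _ xI.
      have : x < b (r s) by near: x; exact: lt_nbhsl.
      by have := lt _ _ rs0 rx rx1; lra.
    move: (rs1); rewrite le_eqVlt => /orP[/eqP r1|r1].
      rewrite near_withinE; near=> x => /=; rewrite in_itv/= => xI.
      by have := rI _ xI; rewrite r1; lra.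
    have [|t1 [st1 t11 t1P]] := @near_right _ _ f (r s) e Df _ e0.
      by rewrite rs0.
    have h1 := near_clock_lt abr sI st1 t11.
    near=> x => rx.
    have xI : 0 <= x <= 1 by near: x; exact: inI.
    have [|fx lx] := t1P (r x).
      by rewrite rx; near: x; exact: h1.
    rewrite (blendb s)// distrC; apply: norm_convex_dist => //.
    exact: weight01 abr _ xI.
  have left : \forall x \near within `[0, 1] (nbhs s), r x < r s ->
      `|blend f a b r s - blend f a b r x| <= e.
    move: ars; rewrite le_eqVlt => /orP[/eqP ars|ars]; last first.
      rewrite near_withinE; near=> x => /=; rewrite in_itv/= => xI rx.
      have /andP[rx0 rx1] := rI _ xI; have /andP[_ brx] := rP _ xI.
      have : a (r s) < x by near: x; exact: lt_nbhsr.
      by have := lt _ _ rx0 rx rs1; lra.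
    move: (rs0); rewrite le_eqVlt => /orP[/eqP r1|r1].
      rewrite near_withinE; near=> x => /=; rewrite in_itv/= => xI.
      by have := rI _ xI; rewrite -r1; lra.
    have [|t1 [t10 st1 t1P]] := @near_left _ _ f (r s) e Df _ e0.
      by rewrite r1.
    have h1 := near_clock_gt abr sI t10 st1.
    near=> x => rx.
    have xI : 0 <= x <= 1 by near: x; exact: inI.
    have [|fx lx] := t1P (r x).
      by rewrite rx andbT; near: x; exact: h1.
    rewrite (blenda s)// distrC; apply: norm_convex_dist => //.
    exact: weight01 abr _ xI.
  near=> x; have [rx|rx|rx] := ltgtP (r x) (r s).
  + by move: rx; near: x.
  + by move: rx; near: x.
  + by move: rx; near: x.
- exact: clock_continuous abr.
- by move=> s; rewrite /= !in_itv/=; exact: rI.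
- move=> s t s0 st t1; rewrite /graph_le /=.
  have sI : 0 <= s <= 1 by rewrite s0 (le_trans st).
  have tI : 0 <= t <= 1 by rewrite t1 (le_trans s0).
  have := clock_homo abr s0 st t1; rewrite le_eqVlt => /orP[/eqP rst|]; last by left.
  right; split=> //.
  have dev x : 0 <= x <= 1 -> enorm (left_limit f (r x) - blend f a b r x) =
      (1 - weight a b r x) * enorm (left_limit f (r x) - f (r x)).
    move=> xI; rewrite -enormZ; last first.
      by have := weight01 abr xI; lra.
    congr enorm; rewrite /blend; move: (weight a b r x) => al.
    by apply/rowP => i; rewrite !mxE; ring.
  rewrite !dev// -rst ler_wpM2r ?enorm_ge0// lerD2l lerN2 /weight -rst.
  rewrite ler_wpM2r ?lerD2l ?lerN2// invr_ge0 subr_ge0.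
  by have [] := ab _ (rI _ sI).
- apply/seteqP; split=> [_ [s /= sI <-]|[z t] [/= tI [al /= alI <-]]].
    rewrite in_itv/= in sI; split=> /=; first exact: rI.
    exists (weight a b r s) => //; rewrite /= in_itv/=.
    exact: weight01 abr _ sI.
  rewrite in_itv/= in alI; have /andP[al0 al1] := alI.
  have [a0 abt b1] := ab _ tI.
  pose s := al * a t + (1 - al) * b t.
  have sab : a t <= s <= b t by rewrite /s; nra.
  have sI : 0 <= s <= 1 by move: sab; lra.
  have rst : r s = t by exact: clock_eq abr _ _ sI tI sab.
  exists s; first by rewrite /= in_itv.
  congr (_, _); rewrite // /blend rst.
  have [abE|abN] := eqVneq (a t) (b t).
    by rewrite noj// -!scalerDl !(addrC _ (1 - _)) !subrK.
  suff -> : weight a b r s = al by [].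
  rewrite /weight rst /s; field.
  by rewrite subr_eq0 eq_sym.
Unshelve. all: by end_near. Qed.

End ClockParametrization.

(** * Comparing the four distances *)

Section Comparison.
Context {R : realType} {d : nat}.
Implicit Types (f g : R -> 'rV[R]_d) (a b r lambda mu : R -> R) (e s t : R).

Lemma enorm_distC (x y : 'rV[R]_d) : enorm (x - y) = enorm (y - x).
Proof.
rewrite /enorm; congr Num.sqrt; apply: eq_bigr => i _.
by rewrite !mxE -sqrrN opprB.
Qed.

Lemma hausdorff_dist_ge0 (A B : set ('rV[R]_d * R)) :
  (0 <= hausdorff_dist A B)%E.
Proof.
by apply: le_ereal_inf_tmp => _ [e [e0 _ _] <-]; rewrite lee_fin ltW.
Qed.

Lemma sup_norm_ge0 (V : Type) (N : V -> R) (h : R -> V) :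
  (forall v, 0 <= N v) -> (0 <= sup_norm N h)%E.
Proof.
move=> N0; apply: le_ereal_sup_tmp; exists (N (h 0))%:E.
  by exists 0 => //; rewrite /= in_itv/= lexx ler01.
by rewrite lee_fin.
Qed.

Lemma skorokhod_dist_ge0 T f g : (0 <= skorokhod_dist T f g)%E.
Proof.
case: T => /=; try exact: hausdorff_dist_ge0.
- apply: le_ereal_inf_tmp => _ [lambda _ <-].
  rewrite le_max; apply/orP; left.
  by apply: sup_norm_ge0 => v; exact: enorm_ge0.
- apply: le_ereal_inf_tmp => _ [u1 [r1 [u2 [r2 [_ _ ->]]]]].
  rewrite le_max; apply/orP; left.
  by apply: sup_norm_ge0 => v; exact: enorm_ge0.
Qed.

Lemma sup_norm_le (V : Type) (N : V -> R) (h : R -> V) e :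
  (forall s, 0 <= s <= 1 -> N (h s) <= e) -> (sup_norm N h <= e%:E)%E.
Proof.
move=> he; apply: ge_ereal_sup => _ [s /= sI <-].
rewrite in_itv/= in sI; by rewrite lee_fin he.
Qed.

(** Matching the fibre over [lambda t] with the fibre over [t] gives the
    Hausdorff bound for both kinds of graphs. *)
Lemma hausdorff_dist_fibres (A B : R -> set 'rV[R]_d) lambda mu e :
  0 < e -> unit_iso lambda mu ->
  (forall t, 0 <= t <= 1 -> `|lambda t - t| <= e) ->
  (forall t z, 0 <= t <= 1 -> A (lambda t) z ->
     exists2 w, B t w & enorm (z - w) <= e) ->
  (forall t w, 0 <= t <= 1 -> B t w ->
     exists2 z, A (lambda t) z & enorm (z - w) <= e) ->
  (hausdorff_dist [set p | (0 <= p.2 <= 1)%R /\ A p.2 p.1]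
     [set p | (0 <= p.2 <= 1)%R /\ B p.2 p.1] <= e%:E)%E.
Proof.
move=> e0 [l01 m01 lK mK _] le AB BA; apply: ereal_inf_lbound.
exists e => //; split=> // -[z t] [/= tI Pz]; split=> //=.
- have [|w Bw zw] := AB (mu t) z (m01 _ tI); first by rewrite lK.
  exists (w, mu t); first by split=> //; exact: m01.
  by rewrite ge_max zw /= -[X in X - _](lK t)// le// m01.
- have [w Aw zw] := BA t z tI Pz.
  exists (w, lambda t); first by split=> //; exact: l01.
  by rewrite ge_max enorm_distC zw distrC le.
Qed.

Lemma enorm_convex_dist (x x' z z' : 'rV[R]_d) (al e : R) : 0 <= al <= 1 ->
  enorm (x - x') <= e -> enorm (z - z') <= e ->
  enorm (al *: x + (1 - al) *: z - (al *: x' + (1 - al) *: z')) <= e.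
Proof.
move=> al01 xe ze; rewrite opprD addrACA -!scalerBr.
exact: enorm_convex.
Qed.

Lemma matching_dist_J2 f g lambda mu e : 0 < e ->
  J1_matching f g lambda mu e -> (dist_J2 f g <= e%:E)%E.
Proof.
move=> e0 [iso fe le_ le].
apply: (@hausdorff_dist_fibres
  (fun t => [set z | z = left_limit f t \/ z = f t])
  (fun t => [set z | z = left_limit g t \/ z = g t]) _ _ _ e0 iso le).
- move=> t z tI [->|->]; [exists (left_limit g t)|exists (g t)].
  + by left.
  + exact: le_.
  + by right.
  + exact: fe.
- move=> t z tI [->|->]; [exists (left_limit f (lambda t))|exists (f (lambda t))].
  + by left.
  + exact: le_.
  + by right.
  + exact: fe.
Qed.

Lemma matching_dist_M2 f g lambda mu e : 0 < e ->
  J1_matching f g lambda mu e -> (dist_M2 f g <= e%:E)%E.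
Proof.
move=> e0 [iso fe le_ le].
apply: (@hausdorff_dist_fibres
  (fun t => segment (left_limit f t) (f t))
  (fun t => segment (left_limit g t) (g t)) _ _ _ e0 iso le).
- move=> t z tI [al alI <-].
  exists (al *: left_limit g t + (1 - al) *: g t); first by exists al.
  by apply: enorm_convex_dist; [move: alI; rewrite /= in_itv|exact: le_|exact: fe].
- move=> t z tI [al alI <-].
  exists (al *: left_limit f (lambda t) + (1 - al) *: f (lambda t)).
    by exists al.
  by apply: enorm_convex_dist; [move: alI; rewrite /= in_itv|exact: le_|exact: fe].
Qed.

(** The slot of a time is handed over to its image under [lambda]. *)
Lemma clock_time_change a b r lambda mu : unit_iso lambda mu ->
  clock a b r -> clock (a \o mu) (b \o mu) (lambda \o r).
Proof.
move=> iso [ab lt rI rP]; have [l01 m01 lK mK _] := iso.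
have [_ _ _ _ mlt] := unit_iso_sym iso.
split=> [t tI|s t s0 st t1|s sI|s sI] /=.
- exact: ab (m01 _ tI).
- have sI : 0 <= s <= 1 by lra.
  have tI : 0 <= t <= 1 by lra.
  by apply: lt; rewrite ?mlt//; [case/andP: (m01 _ sI)|case/andP: (m01 _ tI)].
- exact: l01 (rI _ sI).
- by rewrite mK ?rI// rP.
Qed.

(** One clock must stop at the jumps of [g] and at the preimages under [lambda]
    of the jumps of [f]; adding the identity makes the gauge strictly
    increasing. *)
Lemma matching_clock f g lambda mu : D01 f -> D01 g -> unit_iso lambda mu ->
  exists a b r, [/\ clock a b r, forall t, jumps g t -> a t < b t
    & forall t, jumps f t -> a (mu t) < b (mu t)].
Proof.
move=> Df Dg iso; have [l01 m01 lK mK llt] := iso.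
have [Sf [Sfle Sfgap]] := jump_gauge Df.
have [Sg [Sgle Sggap]] := jump_gauge Dg.
have lle s t : 0 <= s <= 1 -> 0 <= t <= 1 -> s <= t -> lambda s <= lambda t.
  by move=> sI tI; rewrite !leNgt llt.
have [|a [b [r [abr abP]]]] := @gauge_clock R (fun t => t + Sg t + Sf (lambda t)).
  move=> s t s0 st t1; rewrite ltr_leD//.
    by rewrite ltr_leD// Sgle// ltW.
  by apply/Sfle/lle; lra.
exists a, b, r; split=> // t jt.
- have t01 := jumps_itvoo Dg jt; apply: abP; first by lra.
  have [c c0 cP] := Sggap t jt; exists c => // s t' s0 st tt t1.
  rewrite addrAC lerD//; last by apply/Sfle/lle; lra.
  by rewrite -addrA lerD ?cP//; lra.
- have t01 := jumps_itvoo Df jt.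
  have tI : 0 <= t <= 1 by lra.
  have mI := m01 _ tI.
  have I0 : 0 <= (0 : R) <= 1 by lra.
  have m0 : 0 < mu t.
    by rewrite -llt// lK// (unit_iso0 iso); lra.
  apply: abP; first by lra.
  have [c c0 cP] := Sfgap t jt; exists c => // s t' s0 st tt t1.
  have sI : 0 <= s <= 1 by lra.
  have t'I : 0 <= t' <= 1 by lra.
  rewrite -addrA lerD//.
    by apply: lerD; [lra|apply: Sgle; lra].
  apply: cP.
  + by case/andP: (l01 _ sI).
  + by rewrite -[ltRHS](lK t)// llt.
  + by rewrite -[leLHS](lK t)// lle.
  + by case/andP: (l01 _ t'I).
Qed.

(** Since [mu (lambda (r s)) = r s], the clock and its transport give the same
    weight to [s], so the two parametrizations differ by a convex combination
    of the differences of left limits and of values. *)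
Lemma matching_dist_M1 f g lambda mu e : D01 f -> D01 g ->
  J1_matching f g lambda mu e -> (dist_M1 f g <= e%:E)%E.
Proof.
move=> Df Dg [iso fe le_ le]; have [l01 m01 lK mK _] := iso.
have [a [b [r [abr gab fab]]]] := matching_clock Df Dg iso.
have abr' := clock_time_change iso abr.
have [_ _ rI _] := abr.
apply: ge_ereal_inf; exists (maxe
  (sup_norm enorm
    (blend f (a \o mu) (b \o mu) (lambda \o r) \- blend g a b r))
  (sup_norm Num.norm (lambda \o r \- r))).
  exists (blend f (a \o mu) (b \o mu) (lambda \o r)), (lambda \o r).
  exists (blend g a b r), r; split=> //; exact: clock_parametrization.
rewrite ge_max; apply/andP; split; apply: sup_norm_le => s sI /=.
  rewrite /blend /weight /= mK ?rI//.
  by apply: enorm_convex_dist;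
    [exact: (weight01 abr sI)|apply: le_; exact: rI|apply: fe; exact: rI].
by rewrite le// rI.
Qed.

Lemma skorokhod_dist_le_J1 T f g e : D01 f -> D01 g -> 0 < e -> e <= 2^-1 ->
  (dist_J1 f g < e%:E)%E -> (skorokhod_dist T f g <= e%:E)%E.
Proof.
move=> Df Dg e0 e2 fge.
have [lambda [mu M]] := dist_J1_matching Df Dg e2 fge.
case: T => /=.
- exact: ltW.
- exact: matching_dist_J2 e0 M.
- exact: matching_dist_M1 M.
- exact: matching_dist_M2 e0 M.
Qed.

Lemma cvge_to0 (v : nat -> \bar R) : (forall n, (0 <= v n)%E) ->
  (forall e : R, 0 < e -> \forall n \near \oo, (v n <= e%:E)%E) ->
  v @ \oo --> 0%E.
Proof.
move=> v0 ve; apply/fine_cvgP; split.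
  near=> n; rewrite ge0_fin_numE//.
  apply: le_lt_trans (ltry 1); near: n; exact: ve.
apply/cvgrPdist_le => e e0; near=> n.
have vn : (v n <= e%:E)%E by near: n; exact: ve.
rewrite sub0r normrN /= ger0_norm ?fine_ge0// -lee_fin fineK//.
by rewrite ge0_fin_numE// (le_lt_trans vn)// ltry.
Unshelve. all: by end_near. Qed.

Lemma converges_in_J1 T (f_ : nat -> R -> 'rV[R]_d) :
  (\forall n \near \oo, D01 (f_ n)) ->
  converges_in J1 f_ -> converges_in T f_.
Proof.
move=> Df_ [f [Df f0]]; exists f; split=> //.
apply: cvge_to0 => [n|e e0]; first exact: skorokhod_dist_ge0.
pose e' := Num.min e 2^-1.
have e'0 : 0 < e' by rewrite lt_min e0 invr_gt0 ltr0n.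
have /fine_cvgP[dfin_ dfine] := f0.
near=> n; apply: (@le_trans _ _ e'%:E).
  apply: skorokhod_dist_le_J1 => //.
  - by near: n.
  - by rewrite ge_min lexx orbT.
  have dfin : dist_J1 (f_ n) f \is a fin_num by near: n.
  rewrite -(fineK dfin) lte_fin; apply: le_lt_trans (ler_norm _) _.
  by rewrite -normrN -sub0r; near: n; exact: (cvgrPdist_lt _ _).1 dfine _ e'0.
by rewrite lee_fin ge_min lexx.
Unshelve. all: by end_near. Qed.

End Comparison.

Theorem corollary3p1 (R : realType) (d : nat) (hd : (0 < d)%N)
    (T : skorokhod_topology) (y : nat -> nat -> 'rV[R]_d) :
  converges_in J1 (fun n : nat => step_embedding n (y n)) ->
  converges_in T (fun n : nat => step_embedding n (y n)).
Proof.
apply: converges_in_J1; near=> n; apply: D01_step_embedding.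
by near: n; exact: nbhs_infty_gt.
Unshelve. all: by end_near. Qed.
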